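(* Let $X$ be a vector space over $\mathbb{K}=\mathbb{R}$ or $\mathbb{C}$ and let $N$ be a fuzzy norm on $X$. Assume further that for every $x\in X$ with $x\neq 0$, $N(x,t)$ converges to $0$ when $t\to 0$ (with $t>0$). Write $f_N(x)=N(x,1)$ for $x\in X$, and define for each $0<\alpha<1$ the function $$p_\alpha(x)=\inf\{t>0:N(x,t)>\alpha\}=\inf\{t>0:f_N(x/t)>\alpha\},\qquad x\in X.$$ Then $\mathcal{P}=\{p_\alpha:\alpha\in(0,1)\}$ is an ascending family of norms on $X$.
   Context: A fuzzy norm on a vector space $X$ over $\mathbb{K}$ is a function $N:X\times[0,\infty)\to[0,1]$ satisfying: (N1) $N(x,0)=0$ for all $x\in X$; (N2) [$N(x,t)=1$ for all $t>0$] if and only if $x=0$; (N3) $N(\lambda x,t)=N\left(x,\frac{t}{|\lambda|}\right)$ for all $t\geq 0$, $x\in X$ and $0\neq\lambda\in\mathbb{K}$; (N4) $N(x+y,t+s)\geq\min\{N(x,t),N(y,s)\}$ for all $x,y\in X$ and $t,s\geq 0$; (N5) for each $x\in X$, $\lim_{t\to\infty}N(x,t)=1$. The family $\{p_\alpha\}_{\alpha\in(0,1)}$ of norms is ascending if $p_\beta(x)\leq p_\alpha(x)$ for all $x\in X$ whenever $0<\beta\leq\alpha<1$. *)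

(* Defs.v *)
From HB Require Import structures.
From mathcomp Require Import all_boot all_order all_algebra.
From mathcomp Require Import complex.
From mathcomp Require Import boolp classical_sets reals topology normedtype.
Set Implicit Arguments.
Unset Strict Implicit.
Unset Printing Implicit Defensive.
Import Order.TTheory GRing.Theory Num.Theory.
Import numFieldNormedType.Exports.
Local Open Scope classical_set_scope.
Local Open Scope ring_scope.

Variant scalar_kind := RealScalars | ComplexScalars.

Definition scalar_field (R : realType) (k : scalar_kind) : numFieldType :=
  match k with
  | RealScalars => R
  | ComplexScalars => R[i]
  end.

(* The norm of R[i] takes its values in R[i]; its real part is the modulus
   as an element of R. *)
Definition scalar_abs (R : realType) (k : scalar_kind) : scalar_field R k -> R :=
  match k with
  | RealScalars => fun x : R => `|x|
  | ComplexScalars => fun z : R[i] => complex.Re `|z|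
  end.

Definition scalar_of_real (R : realType) (k : scalar_kind) : R -> scalar_field R k :=
  match k with
  | RealScalars => fun x : R => x
  | ComplexScalars => fun x : R => real_complex R x
  end.

Arguments scalar_abs {R k} _.
Arguments scalar_of_real {R} k _.

(* A function X x [0, +oo[ -> [0, 1] is encoded as a map X -> R -> R, of which
   only the values at second arguments t >= 0 are constrained. *)
Record fuzzy_norm (R : realType) (k : scalar_kind) (X : lmodType (scalar_field R k))
    (N : X -> R -> R) : Prop := FuzzyNorm {
  fuzzy_norm_itv : forall x t, 0 <= t -> 0 <= N x t <= 1;
  fuzzy_norm_at0 : forall x, N x 0 = 0;
  fuzzy_norm_eq1 : forall x, (forall t, 0 < t -> N x t = 1) <-> x = 0;
  fuzzy_normZ : forall (a : scalar_field R k) x t, 0 <= t -> a != 0 ->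
    N (a *: x) t = N x (t / scalar_abs a);
  fuzzy_normD : forall x y t s, 0 <= t -> 0 <= s ->
    Num.min (N x t) (N y s) <= N (x + y) (t + s);
  fuzzy_norm_cvg1 : forall x, N x t @[t --> +oo] --> (1 : R)
}.

(* The norms attached to the library's normed spaces are part of the structure
   of the space and valued in the scalars, whereas here a single vector space
   carries a whole family of real-valued norms. *)
Record is_norm (R : realType) (k : scalar_kind) (X : lmodType (scalar_field R k))
    (p : X -> R) : Prop := IsNorm {
  is_norm_ge0 : forall x, 0 <= p x;
  is_norm_eq0 : forall x, p x = 0 <-> x = 0;
  is_normZ : forall (a : scalar_field R k) x, p (a *: x) = scalar_abs a * p x;
  is_normD : forall x y, p (x + y) <= p x + p y
}.

Definition ascending_norms (R : realType) (k : scalar_kind)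
    (X : lmodType (scalar_field R k)) (p : R -> X -> R) : Prop :=
  (forall a, 0 < a < 1 -> is_norm (p a)) /\
  (forall a b x, 0 < b -> b <= a -> a < 1 -> p b x <= p a x).

Definition fN (R : realType) (k : scalar_kind) (X : lmodType (scalar_field R k))
    (N : X -> R -> R) (x : X) : R := N x 1.

Definition p_alpha (R : realType) (k : scalar_kind) (X : lmodType (scalar_field R k))
    (N : X -> R -> R) (a : R) (x : X) : R :=
  inf [set t : R | 0 < t /\ a < N x t].

(* Main.v *)
Require Import Defs.
From mathcomp Require Import all_boot all_order all_algebra.
From mathcomp Require Import complex.
From mathcomp Require Import boolp classical_sets reals topology normedtype.
Import Order.TTheory GRing.Theory Num.Theory.
Import numFieldNormedType.Exports.
Local Open Scope classical_set_scope.
Local Open Scope ring_scope.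

(** A fuzzy norm is, in its real argument, a nondecreasing function climbing to
    [1], and [p_alpha N a x] is the point where [N x] crosses the level [a].
    The norm axioms are thus the axioms of [N] read on the superlevel sets
    [S a x = {t > 0 | a < N x t}] and passed to the infimum.  The minimum in
    [fuzzy_normD] puts [S a x + S a y] inside [S a (x + y)], and [fuzzy_normZ]
    makes [S a (c *: x)] the dilation of [S a x] by the modulus of [c != 0]:
    this gives subadditivity ([p_alphaD]) and homogeneity ([p_alphaZ]).  The
    limit [1] at infinity makes [S a x] nonempty, so that its infimum is a
    greatest lower bound ([le_p_alpha]), while the limit [0] at [0] keeps
    [S a x] away from [0] when [x != 0], which is definiteness
    ([p_alpha_gt0]).  The family ascends because [S a x] shrinks as [a] grows.
    The formula through [fN] is [fuzzy_normZ] with scalar [t^-1]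
    ([fN_scaleV]). *)

Lemma scalar_abs0 {R : realType} {k : scalar_kind} :
  scalar_abs (0 : scalar_field R k) = 0.
Proof. by case: k; rewrite /scalar_abs normr0. Qed.

Lemma scalar_abs_gt0 {R : realType} {k : scalar_kind} {c : scalar_field R k} :
  c != 0 -> 0 < scalar_abs c.
Proof.
case: k c => /= c c0; first by rewrite normr_gt0.
by move: c0; rewrite -normr_gt0 ltcE => /andP[].
Qed.

Lemma scalar_of_real_neq0 {R : realType} {k : scalar_kind} (t : R) :
  0 < t -> scalar_of_real k t != 0.
Proof.
case: k => /= t0; first exact: lt0r_neq0.
by rewrite fmorph_eq0 lt0r_neq0.
Qed.

Lemma scalar_abs_of_realV {R : realType} {k : scalar_kind} (t : R) :
  0 < t -> scalar_abs (scalar_of_real k t)^-1 = t^-1.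
Proof.
rewrite /scalar_abs /scalar_of_real; case: k => t0.
  by rewrite ger0_norm // invr_ge0 ltW.
have -> : (real_complex R t)^-1 = real_complex R t^-1 by rewrite fmorphV.
by rewrite ger0_norm // ler0c invr_ge0 ltW.
Qed.

Section LevelNorm.
Context {R : realType} {k : scalar_kind} {X : lmodType (scalar_field R k)}.
Context {N : X -> R -> R}.
Implicit Types (a t m : R) (x y : X) (c : scalar_field R k).

Lemma p_alpha_le a x t : 0 < t -> a < N x t -> p_alpha N a x <= t.
Proof. by move=> t0 at_; apply: ge_inf => //; exists 0 => s [/ltW]. Qed.

Hypothesis hN : fuzzy_norm N.

Lemma superlevel_nonempty a x : a < 1 ->
  [set t | 0 < t /\ a < N x t] !=set0.
Proof.
move=> a1.
have large : \forall t \near +oo, 0 < t /\ a < N x t.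
  near=> t; split; first by near: t; exact: nbhs_pinfty_gt.
  by near: t; apply: (cvgr_gt (1 : R)) => //; exact: fuzzy_norm_cvg1 hN x.
exact: (filter_ex large).
Unshelve. all: by end_near. Qed.

(** The converse of [p_alpha_le] needs a nonempty superlevel set, the infimum
    of the empty set being [0] by convention; this is where the limit of [N]
    at infinity enters. *)
Lemma le_p_alpha a x m : a < 1 ->
  (forall t, 0 < t -> a < N x t -> m <= t) -> m <= p_alpha N a x.
Proof.
move=> a1 mS; apply: lb_le_inf; first exact: superlevel_nonempty.
by move=> t [t0 at_]; exact: mS.
Qed.

Lemma p_alpha_ge0 a x : a < 1 -> 0 <= p_alpha N a x.
Proof. by move=> a1; apply: le_p_alpha => // t /ltW. Qed.

Lemma p_alpha0 a : a < 1 -> p_alpha N a 0 = 0.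
Proof.
move=> a1; apply/eqP; rewrite eq_le p_alpha_ge0 // andbT.
apply/ler_addgt0Pl => e e0; rewrite addr0; apply: p_alpha_le => //.
by rewrite (fuzzy_norm_eq1 hN 0).2.
Qed.

(** Convergence of [N x] to [0] at [0] bounds the superlevel set from below by
    a positive number; without it the infimum could vanish at nonzero vectors
    for small [a]. *)
Lemma p_alpha_gt0 a x : 0 < a -> a < 1 ->
  N x t @[t --> 0^'+] --> (0 : R) -> 0 < p_alpha N a x.
Proof.
move=> a0 a1 Nx0.
have : \forall t \near 0^'+, N x t < a by apply: (cvgr_lt (0 : R)).
move=> [e /= e0 Ne]; apply: (lt_le_trans e0).
apply: le_p_alpha => // t t0 at_; rewrite leNgt; apply/negP => te.
suff : N x t < a by rewrite ltNge (ltW at_).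
by apply: Ne => //=; rewrite sub0r normrN gtr0_norm.
Qed.

Lemma p_alphaZ a c x : a < 1 ->
  p_alpha N a (c *: x) = scalar_abs c * p_alpha N a x.
Proof.
move=> a1; have [->|c0] := eqVneq c 0.
  by rewrite scale0r scalar_abs0 mul0r p_alpha0.
have c_gt0 := scalar_abs_gt0 c0.
apply/eqP; rewrite eq_le; apply/andP; split.
- rewrite -ler_pdivrMl //; apply: le_p_alpha => // t t0 at_.
  rewrite ler_pdivrMl //; apply: p_alpha_le; first exact: mulr_gt0.
  rewrite (fuzzy_normZ hN) //; last by rewrite ltW // mulr_gt0.
  by rewrite mulrAC divff ?mul1r // lt0r_neq0.
- apply: le_p_alpha => // t t0; rewrite (fuzzy_normZ hN _ (ltW t0) c0) => at_.
  rewrite -ler_pdivlMl // mulrC; apply: p_alpha_le => //.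
  exact: divr_gt0.
Qed.

Lemma p_alphaD a x y : a < 1 ->
  p_alpha N a (x + y) <= p_alpha N a x + p_alpha N a y.
Proof.
move=> a1; rewrite -lerBlDr; apply: le_p_alpha => // t t0 at_.
rewrite lerBlDr -lerBlDl; apply: le_p_alpha => // s s0 as_.
rewrite lerBlDl; apply: p_alpha_le; first exact: addr_gt0.
apply: lt_le_trans (fuzzy_normD hN _ _ (ltW t0) (ltW s0)).
by rewrite lt_min at_.
Qed.

Lemma p_alpha_homo a b x : b <= a -> a < 1 -> p_alpha N b x <= p_alpha N a x.
Proof.
move=> ba a1; apply: le_p_alpha => // t t0 at_.
by apply: p_alpha_le => //; exact: le_lt_trans at_.
Qed.

Lemma fN_scaleV x t : 0 < t -> fN N ((scalar_of_real k t)^-1 *: x) = N x t.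
Proof.
move=> t0; rewrite /fN (fuzzy_normZ hN) // ?invr_eq0 ?scalar_of_real_neq0 //.
by rewrite scalar_abs_of_realV // invrK mul1r.
Qed.

End LevelNorm.

Theorem theorem3p11 (R : realType) (k : scalar_kind)
    (X : lmodType (scalar_field R k)) (N : X -> R -> R)
    (hN : fuzzy_norm N)
    (hN0 : forall x : X, x != 0 -> N x t @[t --> 0^'+] --> (0 : R)) :
  (forall (a : R) (x : X), 0 < a < 1 ->
     p_alpha N a x =
     inf [set t : R | 0 < t /\ a < fN N ((scalar_of_real k t)^-1 *: x)]) /\
  ascending_norms (p_alpha N).
Proof.
split=> [a x _|].
  congr inf; apply/seteqP; split=> t /= [t0];
    by rewrite (fN_scaleV hN).
split=> [a /andP[a0 a1]|a b x _ ba a1]; last exact: (p_alpha_homo hN).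
split.
- by move=> x; exact: (p_alpha_ge0 hN).
- move=> x; split=> [px0|->]; last exact: (p_alpha0 hN).
  apply/eqP; apply: contraPT px0 => x0; apply/eqP.
  by rewrite gt_eqF // (p_alpha_gt0 hN) //; exact: hN0.
- by move=> c x; exact: (p_alphaZ hN).
- by move=> x y; exact: (p_alphaD hN).
Qed.
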